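(* For any prime $p\ge 5$, both of the following congruences hold: $$\sum_{k=0}^{(p-1)/2}\frac{\binom{2k}{k}}{(2k-1)^2\, 4^k}\equiv (-1)^{\frac{p-1}{2}}\left(2^{p-1}-q_p(2)\right)\pmod{p^2},$$ $$\sum_{k=0}^{(p-1)/2}\frac{\binom{2k}{k}^2}{(2k-1)^3\, 16^k}\equiv 2-2q_p(2)-p\left(q_p(2)^2-4q_p(2)+3\right)\pmod{p^2},$$ where $q_p(2)=(2^{p-1}-1)/p$.
   Context: The integer $q_p(2)=(2^{p-1}-1)/p$ is the Fermat quotient. For rational numbers $x,y$ and a positive integer $m$, $x\equiv y\pmod{p^m}$ means that $x-y\in p^m\mathbb{Z}_{(p)}$, where $\mathbb{Z}_{(p)}$ is the ring of rational numbers whose denominator (in lowest terms) is not divisible by $p$. *)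

(* Defs.v *)
From mathcomp Require Import all_boot all_order all_algebra.

Set Implicit Arguments.
Unset Strict Implicit.
Unset Printing Implicit Defensive.

Import Order.TTheory GRing.Theory Num.Theory.
Local Open Scope ring_scope.

(* The ring Z_(p), as a predicate on rat; [denq x] is the positive denominator
   of x in lowest terms. *)
Definition Zloc (p : nat) : {pred rat} := [pred x : rat | ~~ (p %| `|denq x|)%N].

Definition congr_loc (p m : nat) (x y : rat) : Prop :=
  exists2 z : rat, z \in Zloc p & x - y = p%:R ^+ m * z.

Definition fermat_quotient (p a : nat) : rat := (a%:R ^+ (p - 1)%N - 1) / p%:R.

(* Main.v *)
Require Import Defs.
From mathcomp Require Import all_boot all_order all_algebra.
From mathcomp Require Import ring lra zify.

Set Implicit Arguments.
Unset Strict Implicit.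
Unset Printing Implicit Defensive.

Import Order.TTheory GRing.Theory Num.Theory.
Local Open Scope ring_scope.

(** Write [p = 2n + 1] and [w_k = C(2k,k) / 4^k], so that the sums are those of
    [w_k / (2k-1)^2] and [w_k^2 / (2k-1)^3] over [k <= n].

    The proof replaces [w_k], which does not depend on [p], by
    [u_{n,k} = (-4)^k C(n+k, 2k)], up to sign the coefficient of [x^(2k)] in the
    Chebyshev polynomial [U_{2n}].  Since
    [u_{n,k} = w_k \prod_(j < k) (1 - p^2 / (2j+1)^2)], only even powers of [p]
    occur in the ratio, and [u_{n,k}] and [w_k] agree modulo [p^2]
    ([wallis_congr_cheb]).  The sums over [u_{n,k}] have closed forms for every
    [n], prime or not.

    For the first sum, summation by parts ([sum_wallis_abel]) turns it into
    [w_n + \sum_(k < n) w_k / (2k+1)].  Integrating [U_{2n}] over [0, 1] gives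
    [\sum_(k <= n) u_{n,k} / (2k+1) = (-1)^n / p] ([sum_cheb_div]); removing
    the term [k = n], in which [u_{n,n} = (-4)^n], leaves
    [(-1)^n (1 - 4^n) / p = - (-1)^n q_p(2)].

    For the second sum, put [A_m(n) = \sum_(k <= n) u_{n,k} w_k / (2k-1)^m].
    The relation [(n+1-k) u_{n+1,k} = (n+1+k) u_{n,k}] is linear in [2k-1], so
    [A_(m+1)] satisfies a first-order recurrence in [n] with right-hand side
    made of [A_m] ([moment_rec]).  Solving it three times gives
    [A_3 = 2 - 2 O - 2 p (O - 1)^2 - p], where [O = \sum_(j < n) 1/(2j+1)]
    ([moment3]).

    It remains to compare [O] with the Fermat quotient.  The identity
    [4^n = \prod_(j < n) (1 + p/(2j+1))] ([prod_odd_shift]), expanded modulo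
    [p^3], reads [q_p(2) = O + p (O^2 - O_2) / 2] modulo [p^2], where [O_2] is
    the sum of the [1/(2j+1)^2].  As [p >= 5], [O_2] vanishes modulo [p]
    ([sum_inv_sqr_odd_congr0]). *)

(** * Exact identities over the rationals *)

(* Proves that a rational expression in natural numbers is nonzero because it
   is positive. *)
Ltac posq := apply: lt0r_neq0; rewrite -?natr1;
  repeat match goal with m : nat |- _ =>
    lazymatch goal with
    | _ : is_true (0 <= m%:R :> rat) |- _ => fail
    | _ => have ? := ler0n rat m
    end
  end; lra.

Lemma oddq_neq0 (k : nat) : 2 * k%:R + 1 != 0 :> rat.
Proof. by posq. Qed.

Lemma oddpredq_neq0 (k : nat) : 2 * k%:R - 1 != 0 :> rat.
Proof.
rewrite subr_eq0 -natrM; have -> : (1 : rat) = 1%:R by [].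
rewrite eqr_nat; lia.
Qed.

Definition wallis (k : nat) : rat := 'C(2 * k, k)%:R / 4 ^+ k.

(** Up to the sign [(-1)^n], the coefficient of [x^(2k)] in the Chebyshev
    polynomial [U_{2n}]. *)
Definition cheb_coef (n k : nat) : rat := (-4) ^+ k * 'C(n + k, 2 * k)%:R.

Lemma wallis0 : wallis 0 = 1.
Proof. by rewrite /wallis bin0 expr0 divr1. Qed.

Lemma cheb_coef0 n : cheb_coef n 0 = 1.
Proof. by rewrite /cheb_coef bin0 expr0 mul1r. Qed.

Lemma cheb_coef_diag n : cheb_coef n n = (-4) ^+ n.
Proof. by rewrite /cheb_coef addnn -mul2n binn mulr1. Qed.

Lemma cheb_coef_small n k : (n < k)%N -> cheb_coef n k = 0.
Proof. by move=> nk; rewrite /cheb_coef bin_small ?mulr0 //; lia. Qed.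

Lemma wallisS k : wallis k.+1 = (2 * k%:R + 1) / (2 * k%:R + 2) * wallis k.
Proof.
have h1 := mul_bin_diag (2 * k).+2 k.
have h2 := mul_bin_diag (2 * k).+1 k.
have h3 := mul_bin_left (2 * k).+1 k.
have h : ((k.+1 * 'C(2 * k.+1, k.+1)) = 2 * (2 * k).+1 * 'C(2 * k, k))%N.
  rewrite /= in h1 h2 h3.
  have -> : (2 * k.+1 = (2 * k).+2)%N by lia.
  have e : ((2 * k).+1 - k = k.+1)%N by lia.
  by rewrite e in h3; nia.
have {}h : (k%:R + 1) * 'C(2 * k.+1, k.+1)%:R
    = 2 * (2 * k%:R + 1) * 'C(2 * k, k)%:R :> rat.
  by move/(congr1 (fun m => m%:R : rat)): h; rewrite !natrM -!natr1 natrM.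
have k0 : k%:R + 1 != 0 :> rat by posq.
have k2 : 2 * k%:R + 2 != 0 :> rat by posq.
have f0 : (4 : rat) ^+ k != 0 by rewrite expf_neq0.
rewrite /wallis.
have -> : 'C(2 * k.+1, k.+1)%:R =
    2 * (2 * k%:R + 1) * 'C(2 * k, k)%:R / (k%:R + 1) :> rat.
  by rewrite -h mulrAC mulfV ?mul1r.
by rewrite exprS; field; rewrite f0 k2 k0.
Qed.

Lemma cheb_coefS n k :
  cheb_coef n k.+1 =
  (2 * k%:R + 1) / (2 * k%:R + 2)
  * (1 - ((2 * n%:R + 1) / (2 * k%:R + 1)) ^+ 2) * cheb_coef n k.
Proof.
have [nk|kn] := ltnP n k.
  by rewrite !cheb_coef_small ?mulr0 //; lia.
have h1 := mul_bin_diag (n + k).+1 (2 * k).+1.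
have h2 := mul_bin_left (n + k) (2 * k).
have e : (n + k - 2 * k = n - k)%N by lia.
rewrite e in h2.
have h : ((2 * k).+2 * ((2 * k).+1 * 'C(n + k.+1, 2 * k.+1)) =
          (n + k).+1 * ((n - k) * 'C(n + k, 2 * k)))%N.
  rewrite /= in h1 h2.
  have -> : (2 * k.+1 = (2 * k).+2)%N by lia.
  by rewrite addnS; nia.
have {}h : (2 * k%:R + 2) * ((2 * k%:R + 1) * 'C(n + k.+1, 2 * k.+1)%:R)
  = (n%:R + k%:R + 1) * ((n%:R - k%:R) * 'C(n + k, 2 * k)%:R) :> rat.
  move/(congr1 (fun m => m%:R : rat)): h.
  rewrite !natrM natrB // -!natr1 natrM natrD => <-.
  ring.
have k0 := oddq_neq0 k.
have k2 : 2 * k%:R + 2 != 0 :> rat by posq.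
rewrite /cheb_coef.
have -> : 'C(n + k.+1, 2 * k.+1)%:R =
    (n%:R + k%:R + 1) * ((n%:R - k%:R) * 'C(n + k, 2 * k)%:R)
    / ((2 * k%:R + 2) * (2 * k%:R + 1)) :> rat.
  by rewrite -h; field; rewrite k0 k2.
by rewrite exprS; field; rewrite k0 k2.
Qed.

(** Every recurrence in [n] below comes from this one, because the factor is a
    quotient of linear functions of [k]. *)
Lemma cheb_coef_step n k :
  cheb_coef n k = (n%:R + 1 - k%:R) / (n%:R + 1 + k%:R) * cheb_coef n.+1 k.
Proof.
have [nk|kn] := ltnP n.+1 k.
  by rewrite !cheb_coef_small ?mulr0 //; lia.
have h := mul_bin_down (n.+1 + k) (2 * k).
have e : (n.+1 + k - 2 * k = n.+1 - k)%N by lia.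
rewrite e addSn /= in h.
move/(congr1 (fun m => m%:R : rat)): h.
rewrite !natrM natrB // -!natr1 natrD => h.
have k0 : n%:R + 1 + k%:R != 0 :> rat by posq.
rewrite /cheb_coef addSn; apply: (mulfI k0).
have -> : (n%:R + 1 + k%:R) * ((-4) ^+ k * 'C(n + k, 2 * k)%:R) =
  (-4) ^+ k * ((n%:R + k%:R + 1) * 'C(n + k, 2 * k)%:R) :> rat by ring.
by rewrite h; field.
Qed.

(** Only the square of [2n+1] occurs in the product: this is what makes the two
    sequences agree modulo [p^2], and not just modulo [p], when [p = 2n+1]. *)
Lemma cheb_coef_prod n k :
  cheb_coef n k =
  wallis k * \prod_(0 <= j < k) (1 - ((2 * n%:R + 1) / (2 * j%:R + 1)) ^+ 2).
Proof.
elim: k => [|k IHk]; first by rewrite cheb_coef0 wallis0 big_geq // mulr1.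
by rewrite big_nat_recr //= cheb_coefS IHk wallisS; ring.
Qed.

Definition oddsum (n : nat) : rat := \sum_(0 <= j < n) (2 * j%:R + 1)^-1.

(** The left-hand side is, up to sign, the integral of [U_{2n}] over [0, 1].
    That integral is [T_{2n+1}(1) / (2n+1)], and [T_{2n+1}(1) = 1]. *)
Lemma sum_cheb_div n :
  \sum_(0 <= k < n.+1) cheb_coef n k / (2 * k%:R + 1) =
  (-1) ^+ n / (2 * n%:R + 1).
Proof.
suff h : (2 * n%:R + 1) * \sum_(0 <= k < n.+1) cheb_coef n k / (2 * k%:R + 1)
   = (-1) ^+ n.
  by rewrite -h mulrC mulKf // oddq_neq0.
elim: n => [|n IHn].
  by rewrite big_nat1 cheb_coef0 !mulr0 !add0r invr1 !mulr1.
rewrite exprS -IHn mulN1r; apply/eqP; rewrite -addr_eq0; apply/eqP.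
have -> : \sum_(0 <= k < n.+1) cheb_coef n k / (2 * k%:R + 1) =
   \sum_(0 <= k < n.+2) cheb_coef n k / (2 * k%:R + 1).
  by rewrite [RHS]big_nat_recr //= cheb_coef_small // mul0r addr0.
rewrite !mulr_sumr -big_split /=.
(* The sum for [n.+1] plus the sum for [n] telescopes.  The certificate [g] is
   Gosper's; writing it with [cheb_coef n.+1] rather than [cheb_coef n] avoids
   a division by zero at [k = n.+1]. *)
pose g k := - (2 * k%:R * cheb_coef n.+1 k / (n%:R + 1 + k%:R)).
rewrite (eq_bigr (fun k => g k.+1 - g k)) => [|k _].
  by rewrite telescope_sumr // /g cheb_coef_small // !(mulr0, mul0r) subrr.
rewrite /g (cheb_coef_step n) cheb_coefS -!natr1.
have k0 := oddq_neq0 k.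
have k1 : k%:R + 1 != 0 :> rat by posq.
have k2 : 2 * k%:R + 2 != 0 :> rat by posq.
have k3 : n%:R + 1 + k%:R != 0 :> rat by posq.
have k4 : n%:R + 1 + (k%:R + 1) != 0 :> rat by posq.
by field; rewrite k0 k2 k3 k4.
Qed.

(** The sum [A_m(n)] of the introduction. *)
Definition moment (m n : nat) : rat :=
  \sum_(0 <= k < n.+1) cheb_coef n k * wallis k / (2 * k%:R - 1) ^+ m.

Lemma moment_widen m n :
  moment m n =
  \sum_(0 <= k < n.+2) cheb_coef n k * wallis k / (2 * k%:R - 1) ^+ m.
Proof. by rewrite [RHS]big_nat_recr //= cheb_coef_small // !mul0r addr0. Qed.

(** With [v = 2k-1], the relation [cheb_coef_step] reads
    [(2n+1-v) u_{n+1,k} = (2n+3+v) u_{n,k}]; multiply by [w_k], divide by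
    [v^(m+1)] and sum over [k]. *)
Lemma moment_rec m n :
  (2 * n%:R + 1) * moment m.+1 n.+1 - moment m n.+1 =
  (2 * n%:R + 3) * moment m.+1 n + moment m n.
Proof.
rewrite !(moment_widen _ n) /moment !mulr_sumr -sumrB -big_split /=.
apply: eq_bigr => k _; rewrite (cheb_coef_step n) exprS.
have k0 := oddpredq_neq0 k.
have k1 : (2 * k%:R - 1) ^+ m != 0 :> rat by rewrite expf_neq0.
have k3 : n%:R + 1 + k%:R != 0 :> rat by posq.
by field; rewrite k0 k1 k3.
Qed.

Lemma moment_n0 m : moment m 0 = (-1) ^+ m.
Proof.
rewrite /moment big_nat1 cheb_coef0 wallis0 mulr0 sub0r !mul1r.
by rewrite -exprVn invrN1.
Qed.

(** By a second telescoping: [A_0(n)] is the value of the Legendre polynomial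
    [P_n] at [-1]. *)
Lemma moment0 n : moment 0 n.+1 = - moment 0 n.
Proof.
apply/eqP; rewrite -addr_eq0; apply/eqP.
rewrite (moment_widen _ n) -big_split /=.
(* Again Gosper's certificate, written in terms of [n.+1]. *)
pose g k := - (2 * k%:R ^+ 2 * (cheb_coef n.+1 k * wallis k)
               / ((n%:R + 1) * (n%:R + 1 + k%:R))).
rewrite (eq_bigr (fun k => g k.+1 - g k)) => [|k _].
  by rewrite telescope_sumr // /g cheb_coef_small // expr0n !(mulr0, mul0r)
    subrr.
rewrite /g (cheb_coef_step n) cheb_coefS wallisS -!natr1 !expr0.
have k0 := oddq_neq0 k.
have k1 : n%:R + 1 != 0 :> rat by posq.
have k2 : 2 * k%:R + 2 != 0 :> rat by posq.
have k3 : n%:R + 1 + k%:R != 0 :> rat by posq.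
have k4 : n%:R + 1 + (k%:R + 1) != 0 :> rat by posq.
by field; rewrite k0 k1 k2 k3 k4.
Qed.

Lemma moment1 n : moment 1 n = - (2 * n%:R + 1).
Proof.
elim: n => [|n IHn]; first by rewrite moment_n0; ring.
apply: (mulfI (oddq_neq0 n)).
have := moment_rec 0 n; rewrite moment0 IHn -(natr1 n) => h.
by rewrite -[LHS](addrK (- - moment 0 n)) h; ring.
Qed.

Lemma oddsumS n : oddsum n.+1 = oddsum n + (2 * n%:R + 1)^-1.
Proof. by rewrite /oddsum big_nat_recr. Qed.

Lemma moment2 n : moment 2 n = (2 * n%:R + 1) * (2 - 2 * oddsum n) - 1.
Proof.
elim: n => [|n IHn]; first by rewrite moment_n0 /oddsum big_geq //; ring.
have n0 := oddq_neq0 n.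
apply: (mulfI n0).
have := moment_rec 1 n; rewrite !moment1 IHn oddsumS -(natr1 n) => h.
by rewrite -[LHS](addrK (- - (2 * (n%:R + 1) + 1))) h; field.
Qed.

Lemma moment3 n :
  moment 3 n = 2 - 2 * oddsum n - 2 * (2 * n%:R + 1) * (oddsum n - 1) ^+ 2
               - (2 * n%:R + 1).
Proof.
elim: n => [|n IHn]; first by rewrite moment_n0 /oddsum big_geq //; ring.
have n0 := oddq_neq0 n.
apply: (mulfI n0).
have := moment_rec 2 n; rewrite !moment2 IHn oddsumS -(natr1 n) => h.
rewrite -[LHS](subrK ((2 * (n%:R + 1) + 1)
  * (2 - 2 * (oddsum n + (2 * n%:R + 1)^-1)) - 1)) h.
by field.
Qed.

(** Summation by parts, from [w_k / (2k-1) = w_(k-1) - w_k]. *)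
Lemma sum_wallis_abel n :
  \sum_(0 <= k < n.+1) wallis k / (2 * k%:R - 1) ^+ 2 =
  wallis n + \sum_(0 <= k < n) wallis k / (2 * k%:R + 1).
Proof.
elim: n => [|n IHn].
  by rewrite big_nat1 big_geq // wallis0; field.
rewrite big_nat_recr // IHn [in RHS]big_nat_recr //= wallisS -(natr1 n).
have n0 := oddq_neq0 n.
have n2 : 2 * n%:R + 2 != 0 :> rat by posq.
by field; rewrite n0 n2.
Qed.

(** The numerators [2n+1 + 2j+1 = 2(n+1+j)] multiply to [2^n (2n)! / n!] and the
    denominators to [(2n)! / (2^n n!)]. *)
Lemma prod_odd_shift n :
  \prod_(0 <= j < n) (1 + (2 * n%:R + 1) / (2 * j%:R + 1)) = 4 ^+ n :> rat.
Proof.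
have rise m : n`!%:R * \prod_(0 <= j < m) (2 * n%:R + 1 + (2 * j%:R + 1))
    = 2 ^+ m * (n + m)`!%:R :> rat.
  elim: m => [|m IHm]; first by rewrite big_geq // expr0 mulr1 mul1r addn0.
  rewrite big_nat_recr //= mulrA IHm addnS factS natrM exprS.
  by rewrite -(natr1 (n + m)) natrD; ring.
have odds m : 2 ^+ m * m`!%:R * \prod_(0 <= j < m) (2 * j%:R + 1) =
    (m + m)`!%:R :> rat.
  elim: m => [|m IHm]; first by rewrite big_geq // !mulr1.
  rewrite big_nat_recr //= addnS addSn !factS !natrM -IHm.
  by rewrite -!natr1 natrD exprS; ring.
have n0 : n`!%:R != 0 :> rat by rewrite pnatr_eq0 -lt0n fact_gt0.
rewrite (eq_bigr (fun j =>
  (2 * n%:R + 1 + (2 * j%:R + 1)) / (2 * j%:R + 1))); last first.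
  by move=> j _; have j0 := oddq_neq0 j; field.
rewrite prodf_div.
have d0 : \prod_(0 <= j < n) (2 * j%:R + 1) != 0 :> rat.
  by rewrite prodf_seq_neq0; apply/allP => j _; rewrite implyTb oddq_neq0.
apply: (mulIf d0); rewrite divfK //; apply: (mulfI n0).
rewrite rise -odds.
have -> : 4 ^+ n = 2 ^+ n * 2 ^+ n :> rat by rewrite -exprMn -natrM.
ring.
Qed.

(** * The ring of p-local rationals and congruences in it *)

(** Membership tested on any denominator, not only on the reduced one; sums and
    products of fractions need no reduction to lowest terms. *)
Lemma ZlocP p (x : rat) :
  reflect (exists2 d : nat, ~~ (p %| d)%N & x * d%:R \is a Num.int)
          (x \in Zloc p).
Proof.
apply: (iffP idP) => [px|[d pd /intrP [z xd]]].
  exists `|denq x|%N => //.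
  by rewrite pmulrn absz_denq -numqE intr_int.
have den0 : (denq x)%:~R != 0 :> rat by rewrite intr_eq0 denq_neq0.
have e : numq x * d%:Z = z * denq x.
  apply/eqP; rewrite -(eqr_int rat) !rmorphM /= numqE -xd; apply/eqP; ring.
have : (`|denq x| %| d)%N.
  rewrite -(@Gauss_dvdr _ `|numq x|); last first.
    by rewrite coprime_sym coprime_num_den.
  by rewrite -[d]/(`|d%:Z|%N) -abszM e abszM dvdn_mull.
by move=> dd; apply: contra pd => /dvdn_trans; apply.
Qed.

Section Localization.
Variable p : nat.
Hypothesis p_prime : prime p.

Let Euclid d e : ~~ (p %| d)%N -> ~~ (p %| e)%N -> ~~ (p %| d * e)%N.
Proof. by rewrite Euclid_dvdM // negb_or => -> ->. Qed.

Lemma Zloc_nat (m : nat) : m%:R \in Zloc p.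
Proof.
apply/ZlocP; exists 1%N; first by rewrite dvdn1; case: p p_prime => [|[]].
by rewrite mulr1 natr_int.
Qed.

Lemma ZlocD x y : x \in Zloc p -> y \in Zloc p -> x + y \in Zloc p.
Proof.
move=> /ZlocP[d pd xd] /ZlocP[e pe ye]; apply/ZlocP.
exists (d * e)%N; first exact: Euclid.
have -> : (x + y) * (d * e)%:R = x * d%:R * e%:R + y * e%:R * d%:R.
  by rewrite natrM; ring.
by rewrite rpredD // rpredM // natr_int.
Qed.

Lemma ZlocM x y : x \in Zloc p -> y \in Zloc p -> x * y \in Zloc p.
Proof.
move=> /ZlocP[d pd xd] /ZlocP[e pe ye]; apply/ZlocP.
exists (d * e)%N; first exact: Euclid.
have -> : (x * y) * (d * e)%:R = x * d%:R * (y * e%:R).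
  by rewrite natrM; ring.
by rewrite rpredM.
Qed.

Lemma ZlocN x : x \in Zloc p -> - x \in Zloc p.
Proof.
by move=> /ZlocP[d pd xd]; apply/ZlocP; exists d; rewrite // mulNr rpredN.
Qed.

Lemma ZlocB x y : x \in Zloc p -> y \in Zloc p -> x - y \in Zloc p.
Proof. by move=> ? /ZlocN; apply: ZlocD. Qed.

Lemma ZlocX x m : x \in Zloc p -> x ^+ m \in Zloc p.
Proof.
move=> xp; elim: m => [|m IH]; rewrite ?exprS.
  exact: Zloc_nat 1%N.
exact: ZlocM.
Qed.

Lemma Zloc_natV (d : nat) : ~~ (p %| d)%N -> d%:R^-1 \in Zloc p.
Proof.
move=> pd; apply/ZlocP; exists d => //; rewrite mulVf ?rpred1 //.
by rewrite pnatr_eq0; apply: contraNneq pd => ->.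
Qed.

Lemma Zloc_sum n (F : nat -> rat) :
  (forall k, (k < n)%N -> F k \in Zloc p) -> \sum_(0 <= k < n) F k \in Zloc p.
Proof.
move=> FZ; rewrite big_nat; apply: (big_ind (fun x => x \in Zloc p)).
- exact: Zloc_nat 0%N.
- exact: ZlocD.
- by move=> k; exact: FZ.
Qed.

Lemma Zloc_half : odd p -> 2^-1 \in Zloc p.
Proof.
move=> p_odd; apply: (@Zloc_natV 2); rewrite dvdn_prime2 //.
by apply: contraTneq p_odd => ->.
Qed.

End Localization.

(* Membership in [Zloc p] of an expression built from natural numbers, halves
   and hypotheses by ring operations.  The dispatch is syntactic: comparing
   rationals up to conversion would evaluate them. *)
Ltac zloc := repeat match goal with
  | H : is_true (?x \in _) |- is_true (?x \in _) => exact: H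
  | |- is_true (prime _) => assumption
  | |- is_true (odd _) => assumption
  | |- is_true (_%:R \in _) => apply: Zloc_nat
  | |- is_true (1 \in _) => apply: (Zloc_nat _ 1)
  | |- is_true (2^-1 \in _) => apply: Zloc_half
  | |- is_true (_ - _ \in _) => apply: ZlocB
  | |- is_true (_ + _ \in _) => apply: ZlocD
  | |- is_true (_ * _ \in _) => apply: ZlocM
  | |- is_true (_ ^+ _ \in _) => apply: ZlocX
  end.

Section Congruence.
Variable p : nat.
Hypothesis p_prime : prime p.

Lemma congr_loc_refl m x : congr_loc p m x x.
Proof. by exists 0; rewrite ?subrr ?mulr0 //; exact: Zloc_nat 0%N. Qed.

Lemma congr_loc_sym m x y : congr_loc p m x y -> congr_loc p m y x.
Proof.
by case=> z pz e; exists (- z); rewrite ?ZlocN // mulrN -e opprB.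
Qed.

Lemma congr_loc_trans m y x z :
  congr_loc p m x y -> congr_loc p m y z -> congr_loc p m x z.
Proof.
case=> u pu e [v pv f]; exists (u + v); first exact: ZlocD.
by rewrite mulrDr -e -f; ring.
Qed.

Lemma congr_locD m x y x' y' :
  congr_loc p m x y -> congr_loc p m x' y' -> congr_loc p m (x + x') (y + y').
Proof.
case=> u pu e [v pv f]; exists (u + v); first exact: ZlocD.
by rewrite mulrDr -e -f; ring.
Qed.

Lemma congr_locMr m x y z : z \in Zloc p ->
  congr_loc p m x y -> congr_loc p m (x * z) (y * z).
Proof.
move=> pz [u pu e]; exists (u * z); first exact: ZlocM.
by rewrite mulrA -e; ring.
Qed.

Lemma congr_loc_sum m n (F G : nat -> rat) :
  (forall k, (k < n)%N -> congr_loc p m (F k) (G k)) ->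
  congr_loc p m (\sum_(0 <= k < n) F k) (\sum_(0 <= k < n) G k).
Proof.
elim: n => [|n IHn] FG; first by rewrite !big_geq //; exact: congr_loc_refl.
rewrite !big_nat_recr //=; apply: congr_locD; last exact: FG.
by apply: IHn => k kn; apply: FG; lia.
Qed.

Lemma prod_sqr_congr1 n (x : nat -> rat) :
  (forall j, (j < n)%N -> x j \in Zloc p) ->
  congr_loc p 2 (\prod_(0 <= j < n) (1 - (p%:R * x j) ^+ 2)) 1.
Proof.
elim: n => [|n IHn] xZ; first by rewrite big_geq //; exact: congr_loc_refl.
rewrite big_nat_recr //=; case: IHn => [j jn|w wZ e]; first by apply: xZ; lia.
have xn := xZ n (leqnn _).
exists (w * (1 - (p%:R * x n) ^+ 2) - x n ^+ 2).
  zloc.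
by rewrite -[X in X * _](subrK 1) e; ring.
Qed.

(** Expansion to second order: the second elementary symmetric function of the
    [x j] is [(s^2 - t) / 2] by Newton's identity. *)
Lemma prod_expand2 (p_odd : odd p) n (x : nat -> rat) :
  let s := \sum_(0 <= j < n) x j in
  let t := \sum_(0 <= j < n) x j ^+ 2 in
  (forall j, (j < n)%N -> x j \in Zloc p) ->
  congr_loc p 3 (\prod_(0 <= j < n) (1 + p%:R * x j))
    (1 + p%:R * s + p%:R ^+ 2 * ((s ^+ 2 - t) / 2)).
Proof.
elim: n => [|n IHn] /= xZ.
  by rewrite !big_geq //; exists 0; [exact: Zloc_nat 0%N | ring].
rewrite !big_nat_recr //=; case: IHn => [j jn|w wZ e]; first by apply: xZ; lia.
have xn := xZ n (leqnn _).
set s := \sum_(0 <= j < n) x j in e *.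
set t := \sum_(0 <= j < n) x j ^+ 2 in e *.
have sZ : s \in Zloc p by apply: Zloc_sum => // k kn; apply: xZ; lia.
have tZ : t \in Zloc p.
  by apply: Zloc_sum => // k kn; apply: ZlocX => //; apply: xZ; lia.
exists (w * (1 + p%:R * x n) + x n * ((s ^+ 2 - t) / 2)).
  zloc.
rewrite -[X in X * _](subrK (1 + p%:R * s + p%:R ^+ 2 * ((s ^+ 2 - t) / 2))).
by rewrite e; field.
Qed.

End Congruence.

(** * Congruences for an odd prime p = 2n + 1 *)

Section OddPrime.
Variable n : nat.
Let p := (2 * n).+1.
Hypothesis p_prime : prime p.

Let p_odd : odd p. Proof. by rewrite /p /= mul2n odd_double. Qed.
Let pE : p%:R = 2 * n%:R + 1 :> rat.
Proof. by rewrite /p -(natr1 (2 * n)) natrM. Qed.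

Lemma Zloc_inv_lt i : (0 < i < p)%N -> i%:R^-1 \in Zloc p.
Proof.
case/andP=> i0 ip; apply: Zloc_natV => //; apply/negP => /dvdn_leq; lia.
Qed.

Lemma Zloc_inv_odd j : (j < n)%N -> (2 * j%:R + 1)^-1 \in Zloc p.
Proof.
move=> jn; rewrite -natrM natr1; apply: Zloc_inv_lt; rewrite /p; lia.
Qed.

Lemma Zloc_inv_oddpred k : (k <= n)%N -> (2 * k%:R - 1)^-1 \in Zloc p.
Proof.
case: k => [|k] kn; first by rewrite mulr0 sub0r invrN1 ZlocN // (Zloc_nat _ 1).
have -> : 2 * k.+1%:R - 1 = 2 * k%:R + 1 :> rat by rewrite -(natr1 k); ring.
exact: Zloc_inv_odd.
Qed.

Lemma Zloc_wallis k : wallis k \in Zloc p.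
Proof.
have -> : wallis k = 'C(2 * k, k)%:R * (2^-1 ^+ 2) ^+ k.
  by rewrite /wallis -exprVn; congr (_ * _ ^+ _); field.
by apply: ZlocM; [|exact: Zloc_nat|do 2 apply: ZlocX => //; exact: Zloc_half].
Qed.

Lemma wallis_congr_cheb k :
  (k <= n)%N -> congr_loc p 2 (wallis k) (cheb_coef n k).
Proof.
move=> kn; apply: congr_loc_sym => //; rewrite cheb_coef_prod mulrC -pE.
rewrite -[X in congr_loc _ _ _ X]mul1r.
apply: congr_locMr => //; first exact: Zloc_wallis.
apply: prod_sqr_congr1 => // j jk; apply: Zloc_inv_odd; lia.
Qed.

Lemma inv_sqr_reflect i : (0 < i < p)%N ->
  congr_loc p 1 ((p - i)%N%:R ^- 2) (i%:R ^- 2).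
Proof.
move=> ip; have [i0 ip'] := andP ip.
exists ((2 * i%:R - p%:R) * ((p - i)%N%:R^-1) ^+ 2 * (i%:R^-1) ^+ 2).
  have ? : (p - i)%:R^-1 \in Zloc p by apply: Zloc_inv_lt; lia.
  have ? := Zloc_inv_lt ip.
  zloc.
have h1 : i%:R != 0 :> rat by rewrite pnatr_eq0; lia.
have h2 : p%:R - i%:R != 0 :> rat by rewrite -natrB 1?ltnW // pnatr_eq0; lia.
by rewrite natrB 1?ltnW //; field; rewrite h1 h2.
Qed.

(** Let [O] and [E] be the sums of [1/i^2] over the odd and the even [i] in
    [1, 2n].  The reflection [i -> p - i] gives [O = E] modulo [p].  It also
    exchanges the two halves of [1, 2n], so that [O + E] is twice the sum of
    [1/i^2] over [i <= n], which is [4 E].  Hence [6 E = 0], and [6] is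
    invertible because [p >= 5]. *)
Lemma sum_inv_sqr_odd_congr0 (p_ge5 : (5 <= p)%N) :
  congr_loc p 1 (\sum_(0 <= j < n) (2 * j%:R + 1) ^- 2) 0.
Proof.
set O := \sum_(_ <= _ < _) _.
pose E : rat := \sum_(0 <= j < n) (2 * j%:R + 2) ^- 2.
pose H m : rat := \sum_(0 <= i < m) i.+1%:R ^- 2.
have parity : H (2 * n)%N = O + E.
  rewrite /H /O /E; elim: (n) => [|m IHm]; first by rewrite muln0 !big_geq.
  have -> : (2 * m.+1 = (2 * m).+2)%N by lia.
  rewrite !big_nat_recr //= IHm -!(natr1 _.+1) -!(natr1 (_ * _)) natrM.
  rewrite -[_ + 1 + 1]addrA; ring.
have dilate : H n = 4 * E.
  rewrite /H /E mulr_sumr; apply: eq_bigr => j _; rewrite -(natr1 j).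
  have j1 : j%:R + 1 != 0 :> rat by posq.
  have j2 : 2 * j%:R + 2 != 0 :> rat by posq.
  by field; rewrite j1 j2.
have reflect_half : congr_loc p 1 (H (2 * n)%N) (2 * H n).
  have -> : H (2 * n)%N = H n + \sum_(0 <= i < n) (n + i).+1%:R ^- 2.
    rewrite /H (@big_cat_nat _ _ _ n) //=; last by lia.
    congr (_ + _); rewrite -{1}[n]add0n big_addn.
    have -> : (2 * n - n = n)%N by lia.
    by apply: eq_bigr => i _; rewrite addnC.
  rewrite [2 * _](_ : _ = H n + H n); last by ring.
  apply: congr_locD => //; first exact: congr_loc_refl.
  rewrite /H [X in congr_loc _ _ _ X]big_nat_rev /=.
  apply: congr_loc_sum => // i iN.
  have -> : ((n + i).+1 = p - (0 + n - i.+1).+1)%N by rewrite /p; lia.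
  apply: inv_sqr_reflect; rewrite /p; lia.
have reflect_parity : congr_loc p 1 O E.
  rewrite /O big_nat_rev /=; apply: congr_loc_sum => // i iN.
  have -> : 2 * (0 + n - i.+1)%:R + 1 = (p - (2 * i).+2)%:R :> rat.
    rewrite -natrM natr1; congr _%:R; rewrite /p; lia.
  have -> : 2 * i%:R + 2 = (2 * i).+2%:R :> rat.
    by rewrite -(natr1 (2 * i).+1) -(natr1 (2 * i)) natrM; ring.
  apply: inv_sqr_reflect; rewrite /p; lia.
case: reflect_half => u uZ; rewrite parity dilate => hu.
case: reflect_parity => v vZ hv.
have sixZ : 6^-1 \in Zloc p.
  apply: (@Zloc_natV p 6); apply/negP; rewrite -[6%N]/(2 * 3)%N Euclid_dvdM //.
  by case/orP => /dvdn_leq; lia.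
(* From [O + E - 2 (4 E) = p u] and [O - E = p v], [6 O = p (7 v - u)]. *)
exists (6^-1 * (7 * v - u)).
  zloc.
rewrite expr1 in hu hv *.
have -> : p%:R * (6^-1 * (7 * v - u)) =
    6^-1 * (7 * (p%:R * v) - p%:R * u) by ring.
by rewrite -hu -hv; field.
Qed.

Lemma fermat_quotient2E :
  1 + p%:R * fermat_quotient p 2 = 4 ^+ n.
Proof.
rewrite /fermat_quotient mulrC divfK ?pnatr_eq0 // subn1 /= exprM -natrX.
by rewrite addrC subrK.
Qed.

Lemma oddsum_Zloc : oddsum n \in Zloc p.
Proof. by apply: Zloc_sum => // j jn; exact: Zloc_inv_odd. Qed.

(** Compare [4^n = 1 + p q] with the second-order expansion of
    [prod_odd_shift]; the sum of squares, which comes with a factor [p], drops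
    out. *)
Lemma fermat_quotient_oddsum (p_ge5 : (5 <= p)%N) :
  congr_loc p 2 (fermat_quotient p 2)
     (oddsum n + p%:R * (oddsum n ^+ 2 / 2)).
Proof.
have [w wZ] := @prod_expand2 p p_prime p_odd n _ Zloc_inv_odd.
rewrite -/(oddsum n) pE prod_odd_shift -pE -fermat_quotient2E => hw.
have := sum_inv_sqr_odd_congr0 p_ge5.
rewrite (eq_bigr (fun j => (2 * j%:R + 1)^-1 ^+ 2)); last first.
  by move=> j _; rewrite exprVn.
set t := \sum_(_ <= _ < _) _ in hw * => -[v vZ]; rewrite subr0 => hv.
exists (w - v / 2).
  zloc.
have p0 : p%:R != 0 :> rat by rewrite pnatr_eq0.
apply: (mulfI p0).
have -> : p%:R * (p%:R ^+ 2 * (w - v / 2)) =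
    p%:R ^+ 3 * w - p%:R ^+ 2 * (p%:R ^+ 1 * v) / 2 by field.
by rewrite -hw -hv; field.
Qed.

Lemma sum_central_binomial_congr :
  congr_loc p 2
    (\sum_(0 <= k < n.+1) wallis k / (2 * k%:R - 1) ^+ 2)
    ((-1) ^+ n * (4 ^+ n - fermat_quotient p 2)).
Proof.
rewrite sum_wallis_abel.
have -> : (-1) ^+ n * (4 ^+ n - fermat_quotient p 2) =
   cheb_coef n n + \sum_(0 <= k < n) cheb_coef n k / (2 * k%:R + 1).
  have := sum_cheb_div n; rewrite big_nat_recr //= cheb_coef_diag -pE.
  move/(canRL (addrK _)) => ->.
  have p0 : p%:R != 0 :> rat by rewrite pnatr_eq0.
  have e4 : (-4) ^+ n = (-1) ^+ n * 4 ^+ n :> rat by rewrite -exprMn mulN1r.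
  apply: (mulfI p0); rewrite e4 -fermat_quotient2E; field; exact: p0.
apply: congr_locD => //; first exact: wallis_congr_cheb.
apply: congr_loc_sum => // k kn; apply: congr_locMr => //.
  exact: Zloc_inv_odd.
by apply: wallis_congr_cheb; lia.
Qed.

Lemma sum_central_binomial_sqr_congr (p_ge5 : (5 <= p)%N) :
  congr_loc p 2
    (\sum_(0 <= k < n.+1) wallis k ^+ 2 / (2 * k%:R - 1) ^+ 3)
    (2 - 2 * fermat_quotient p 2
     - p%:R * (fermat_quotient p 2 ^+ 2 - 4 * fermat_quotient p 2 + 3)).
Proof.
apply: (congr_loc_trans p_prime (y := moment 3 n)).
  apply: congr_loc_sum => // k kn.
  rewrite expr2 -mulrA -[X in congr_loc _ _ _ X]mulrA.
  apply: congr_locMr => //; last by apply: wallis_congr_cheb; lia.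
  apply: ZlocM => //; first exact: Zloc_wallis.
  by rewrite -exprVn; apply: ZlocX => //; apply: Zloc_inv_oddpred; lia.
rewrite moment3 -pE.
have sZ := oddsum_Zloc.
have [w wZ hw] := fermat_quotient_oddsum p_ge5.
set s := oddsum n in sZ hw *; set q := fermat_quotient p 2 in hw *.
clearbody s q.
have [v vZ hv] : exists2 v, v \in Zloc p & q = s + p%:R * v.
  exists (s ^+ 2 / 2 + p%:R * w).
    zloc.
  by rewrite -[q](subrK (s + p%:R * (s ^+ 2 / 2))) hw; field.
(* The difference of the two sides is
   [2 (q - s - p s^2/2) + p (q - s) (2 (s + q - 2) - (s + q))]; both terms are
   multiples of [p^2]. *)
exists (2 * w + 2 * v * (s + q - 2) - v * (s + q)).
  have qZ : q \in Zloc p by rewrite hv; zloc.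
  zloc.
have -> : p%:R ^+ 2 * (2 * w + 2 * v * (s + q - 2) - v * (s + q)) =
  2 * (p%:R ^+ 2 * w) + p%:R * (p%:R * v) * (2 * (s + q - 2) - (s + q)) by ring.
rewrite -hw; have -> : p%:R * v = q - s by rewrite hv; ring.
by field.
Qed.

End OddPrime.

Theorem theorem1p2 (p : nat) (p_prime : prime p) (p_ge5 : (5 <= p)%N) :
  congr_loc p 2
    (\sum_(0 <= k < ((p - 1) %/ 2).+1)
       'C((2 * k)%N, k)%:R / ((2 * k%:R - 1) ^+ 2 * 4 ^+ k))
    ((-1) ^+ ((p - 1) %/ 2)%N * (2 ^+ (p - 1)%N - fermat_quotient p 2))
  /\
  congr_loc p 2
    (\sum_(0 <= k < ((p - 1) %/ 2).+1)
       'C((2 * k)%N, k)%:R ^+ 2 / ((2 * k%:R - 1) ^+ 3 * 16 ^+ k))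
    (2 - 2 * fermat_quotient p 2
     - p%:R * (fermat_quotient p 2 ^+ 2 - 4 * fermat_quotient p 2 + 3)).
Proof.
set n := ((p - 1) %/ 2)%N.
have pE : p = (2 * n).+1.
  have : odd p by case: (even_prime p_prime) => // p2; rewrite p2 in p_ge5.
  rewrite /n; lia.
have p1E : (p - 1 = 2 * n)%N by lia.
rewrite p1E exprM [2 ^+ 2](_ : _ = 4) //.
move: p_prime p_ge5; rewrite pE => p_prime p_ge5; split.
  rewrite (eq_bigr (fun k => wallis k / (2 * k%:R - 1) ^+ 2)).
    exact: sum_central_binomial_congr.
  by move=> k _; rewrite /wallis invfM mulrA mulrAC.
rewrite (eq_bigr (fun k => wallis k ^+ 2 / (2 * k%:R - 1) ^+ 3)).
  exact: sum_central_binomial_sqr_congr.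
move=> k _; rewrite /wallis expr_div_n invfM mulrA mulrAC.
by congr (_ / _ * _); rewrite -exprM mulnC exprM.
Qed.
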